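(* There is an $S^1$-family of integrable Born structures on the real Lie algebra $\mathfrak{nil}_3\oplus\mathbb{R}$.
   Context: The Lie algebra $\mathfrak{nil}_3\oplus\mathbb{R}$ is the 4-dimensional real Lie algebra with basis $e_1,e_2,e_3,e_4$ whose only non-zero bracket relation is $[e_1,e_2]=e_3$ (up to antisymmetry). A Born structure on a Lie algebra $\mathfrak g$ is a triple $(g,h,\omega)$ where $g,h$ are non-degenerate symmetric bilinear forms on $\mathfrak g$ and $\omega$ is a non-degenerate skew-symmetric bilinear form, such that the endomorphisms $A,B,J$ of $\mathfrak g$ determined by $g(AX,Y)=\omega(X,Y)$, $g(BX,Y)=h(X,Y)$, $\omega(-JX,Y)=h(X,Y)$ satisfy $A^2=B^2=-J^2=\mathrm{Id}$. It is integrable if $\omega$ is closed under the Chevalley–Eilenberg differential, the Nijenhuis tensor $N_J(X,Y)=[JX,JY]-[X,Y]-J[JX,Y]-J[X,JY]$ of $J$ vanishes, and the $(\pm1)$-eigenspaces of $A$ are subalgebras of $\mathfrak g$. An $S^1$-family is a family of such structures parametrized (smoothly) by $\theta\in S^1=\mathbb{R}/2\pi\mathbb{Z}$. *)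

(* Defs.v *)
From HB Require Import structures.
From mathcomp Require Import all_boot all_order all_algebra.
From mathcomp Require Import all_classical all_reals all_analysis.

Set Implicit Arguments.
Unset Strict Implicit.
Unset Printing Implicit Defensive.

Import Order.TTheory GRing.Theory Num.Theory.
Import numFieldNormedType.Exports.

Local Open Scope classical_set_scope.
Local Open Scope ring_scope.

HB.mixin Record isLieAlgebra (K : fieldType) L of Vector K L := {
  lie : L -> L -> L;
  lieDl : forall x, {morph (lie^~ x) : y z / y + z};
  lieZl : forall a x y, lie (a *: x) y = a *: lie x y;
  lieDr : forall x, {morph (lie x) : y z / y + z};
  lieZr : forall a x y, lie x (a *: y) = a *: lie x y;
  liexx : forall x, lie x x = 0;
  lie_jacobi : forall x y z,
    lie x (lie y z) + lie y (lie z x) + lie z (lie x y) = 0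
}.

#[short(type="lieAlgType")]
HB.structure Definition LieAlgebra (K : fieldType) :=
  {L of Vector K L & isLieAlgebra K L}.

Section BornStructures.
Variables (K : realFieldType) (L : lieAlgType K).

Record form_triple := FormTriple {
  form_g : {symmetric L};
  form_h : {symmetric L};
  form_w : {skew_symmetric L}
}.

(* If [b] is nondegenerate, there is exactly one such [T] for each
   bilinear [c], so quantifying over [T] below fixes a single endomorphism. *)
Definition is_recursion (b c : L -> L -> K) (T : 'End(L)) : Prop :=
  forall x y, b (T x) y = c x y.

Definition is_born (t : form_triple) : Prop :=
  let: FormTriple g h w := t in
  [/\ nondegenerate g, nondegenerate h, nondegenerate w &
      exists A B J : 'End(L),
        [/\ is_recursion g w A, is_recursion g h B & is_recursion w h (- J)]
        /\ [/\ (A \o A)%VF = \1%VF, (B \o B)%VF = \1%VF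
             & (J \o J)%VF = (- \1)%VF]].

Definition ce_diff (w : L -> L -> K) (x y z : L) : K :=
  - w (lie x y) z + w (lie x z) y - w (lie y z) x.

Definition nijenhuis (J : 'End(L)) (x y : L) : L :=
  lie (J x) (J y) - lie x y - J (lie (J x) y) - J (lie x (J y)).

Definition is_subalgebra (U : {vspace L}) : Prop :=
  {in U &, forall x y, lie x y \in U}.

Definition is_integrable_born (t : form_triple) : Prop :=
  let: FormTriple g h w := t in
  [/\ is_born t,
      forall x y z, ce_diff w x y z = 0,
      forall J, is_recursion w h (- J) -> forall x y, nijenhuis J x y = 0 &
      forall A, is_recursion g w A ->
        is_subalgebra (passmx.leigenspace A 1) /\
        is_subalgebra (passmx.leigenspace A (-1))].

Definition eq_triple (s t : form_triple) : Prop :=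
  [/\ form_g s =2 form_g t, form_h s =2 form_h t & form_w s =2 form_w t].

End BornStructures.

Section CircleFamilies.
Variables (R : realType) (L : lieAlgType R).

Definition smooth (f : R -> R) : Prop :=
  forall (n : nat) (x : R), derivable (derive1n n f) x 1.

Definition smooth_triple (F : R -> form_triple L) : Prop :=
  forall x y : L, [/\ smooth (fun a => form_g (F a) x y),
                      smooth (fun a => form_h (F a) x y)
                    & smooth (fun a => form_w (F a) x y)].

(* A smooth family indexed by R / 2 pi Z, encoded by its pullback to R: the
   equivalence says both that the family is well defined on the circle and that
   distinct points of the circle give distinct triples, so that constant
   families do not qualify. *)
Definition is_circle_family (F : R -> form_triple L) : Prop :=
  smooth_triple F /\
  forall a b : R, eq_triple (F a) (F b) <->
    exists k : int, b - a = k%:~R * (2 * pi).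

End CircleFamilies.

Section Nil3R.
Variable K : fieldType.

Definition nil3R : Type := 'rV[K]_4.

HB.instance Definition _ := Vector.on nil3R.

(* The basis e_1, ..., e_4 is 'e_0, ..., 'e_3. *)
Definition nil3R_lie (x y : nil3R) : nil3R :=
  (x 0 0 * y 0 1 - x 0 1 * y 0 0) *: ('e_2%:R : 'rV[K]_4).

Fact nil3R_lieDl x : {morph (nil3R_lie^~ x) : y z / y + z}.
Proof.
move=> y z; rewrite /nil3R_lie -scalerDl !mxE; congr (_ *: _).
by rewrite !mulrDl opprD addrACA.
Qed.

Fact nil3R_lieZl a x y : nil3R_lie (a *: x) y = a *: nil3R_lie x y.
Proof. by rewrite /nil3R_lie scalerA !mxE mulrBr !mulrA. Qed.

Fact nil3R_liexx x : nil3R_lie x x = 0.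
Proof. by rewrite /nil3R_lie mulrC subrr scale0r. Qed.

Fact nil3R_lieC x y : nil3R_lie x y = - nil3R_lie y x.
Proof.
by rewrite /nil3R_lie -scaleNr opprB [x 0 0 * _]mulrC [x 0 1 * _]mulrC.
Qed.

Fact nil3R_lieDr x : {morph (nil3R_lie x) : y z / y + z}.
Proof.
move=> y z; rewrite nil3R_lieC nil3R_lieDl opprD.
by rewrite -nil3R_lieC -(nil3R_lieC x z).
Qed.

Fact nil3R_lieZr a x y : nil3R_lie x (a *: y) = a *: nil3R_lie x y.
Proof. by rewrite nil3R_lieC nil3R_lieZl -scalerN -nil3R_lieC. Qed.

Fact nil3R_lie_lie x y z : nil3R_lie x (nil3R_lie y z) = 0.
Proof. by rewrite /nil3R_lie !mxE /= !mulr0 subrr scale0r. Qed.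

Fact nil3R_jacobi x y z :
  nil3R_lie x (nil3R_lie y z) + nil3R_lie y (nil3R_lie z x)
  + nil3R_lie z (nil3R_lie x y) = 0.
Proof. by rewrite !nil3R_lie_lie !addr0. Qed.

HB.instance Definition _ := isLieAlgebra.Build K nil3R
  nil3R_lieDl nil3R_lieZl nil3R_lieDr nil3R_lieZr nil3R_liexx nil3R_jacobi.

Lemma nil3R_lie_basis (i j : 'I_4) :
  lie ('e_i : nil3R) ('e_j : nil3R) =
  if (i == 0) && (j == 1) then 'e_2%:R
  else if (i == 1) && (j == 0) then - 'e_2%:R else 0.
Proof.
rewrite /lie /= /nil3R_lie !mxE /=.
case: i => [[|[|[|[|i]]]] //= ?]; case: j => [[|[|[|[|j]]]] //= ?];
  rewrite -?val_eqE /= ?(mulr0, mul0r, mulr1, subr0, sub0r, scale0r, scale1r)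
  ?scaleN1r ?oppr0 ?scale0r //.
Qed.

End Nil3R.

(* Main.v *)
Require Import Defs.
From HB Require Import structures.
From mathcomp Require Import all_boot all_order all_algebra.
From mathcomp Require Import all_classical all_reals all_analysis.
From mathcomp Require Import ring lra.

Set Implicit Arguments.
Unset Strict Implicit.
Unset Printing Implicit Defensive.

Import Order.TTheory GRing.Theory Num.Theory.
Import numFieldNormedType.Exports.

Local Open Scope ring_scope.

(** Unwinding the definition, [B = - A J], the endomorphisms [A] and [J]
    anticommute, and an integrable Born structure amounts to a pseudo-Kaehler
    structure [(w, J)] together with a Lagrangian subalgebra [U] such that [J U]
    is a subalgebra complementary to [U]: then [A] is [1] on [U] and [-1] on
    [J U].

    In nil_3 + R the bracket of [x] and [y] is the determinant of their
    components along e_1, e_2, times e_3. Let [J] rotate both planes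
    <e_1, e_2> and <e_3, e_4> by a quarter turn. On the first plane [J] has
    determinant 1 and trace 0, so [lie (J x) (J y) = lie x y] and
    [lie (J x) y + lie x (J y) = 0]: the Nijenhuis tensor vanishes
    ([born_J_nijenhuis]). A 2-form is closed exactly when it pairs e_3 and e_4
    to zero, so the [J]-invariant form
      [w = p (e^13 + e^24) + q (e^14 - e^23)]
    is symplectic for every [(p, q) <> 0] ([born_w_closed],
    [born_w_nondegenerate]). The plane [U = <e_1, - q e_3 + p e_4>] is
    Lagrangian, and both [U] and [J U = <e_2, - p e_3 - q e_4>] are abelian
    because each projects to a line of <e_1, e_2> ([lie_eigenspace_A]).

    Taking [(p, q)] on the unit circle gives the family. The three forms are
    linear in [(p, q) = (cos a, sin a)], hence smooth in [a]
    ([smooth_born_family]); and w (e_1, e_3) = p, w (e_1, e_4) = q recover the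
    point of the circle ([eq_born_family], [eq_cos_sin]). *)

(** * Uniqueness of recursion operators *)

(** The integrability conditions quantify over all recursion operators; this
    reduces them to the explicit ones. *)
Lemma recursion_uniq (K : realFieldType) (L : lieAlgType K) (eps : bool)
    (b : {hermitian L for eps & idfun}) (c : L -> L -> K) (S T : 'End(L)) :
  nondegenerate b -> is_recursion b c S -> is_recursion b c T -> S = T.
Proof.
move=> /eqP b0 bS bT; apply/lfunP => x; apply/eqP; rewrite -subr_eq0.
rewrite -memv0 -b0; apply/mem_orthovP => y _.
by rewrite linearBl /= bS bT subrr.
Qed.

(** * Block forms and block endomorphisms in coordinates *)

Section Coordinates.
Variable K : realFieldType.
Local Notation V := (nil3R K).
Implicit Types x y z : V.

Definition coords (s : seq K) : V := \row_(i < 4) nth 0 s i.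

Lemma nil3R_eq x y :
  [/\ x 0 0 = y 0 0, x 0 1 = y 0 1, x 0 2 = y 0 2 & x 0 3 = y 0 3] -> x = y.
Proof.
move=> [e0 e1 e2 e3]; apply/rowP => -[[|[|[|[|i]]]] //= lti].
- by rewrite (_ : Ordinal lti = 0) //; apply: val_inj.
- by rewrite (_ : Ordinal lti = 1) //; apply: val_inj.
- by rewrite (_ : Ordinal lti = 2) //; apply: val_inj.
- by rewrite (_ : Ordinal lti = 3) //; apply: val_inj.
Qed.

Lemma nil3R_lieE x y : lie x y = coords [:: 0; 0; x 0 0 * y 0 1 - x 0 1 * y 0 0; 0].
Proof. by apply: nil3R_eq; rewrite /lie /= /nil3R_lie !mxE /= !mulr0 mulr1. Qed.

(** All the forms below make <e_1, e_2> and <e_3, e_4> isotropic, so they are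
    given by the 2 x 2 matrix [(a, b; c, d)] pairing these planes and by a
    sign of symmetry. *)
Section BlockForm.
Variables (eps : bool) (a b c d : K).

Definition pairing x y : K :=
  x 0 0 * (a * y 0 2 + b * y 0 3) + x 0 1 * (c * y 0 2 + d * y 0 3).

Definition block_form x y : K := pairing x y + (-1) ^+ eps * pairing y x.

Fact block_form_bilinear : bilinear_for
  (GRing.Scale.Law.clone _ _ *%R _) (GRing.Scale.Law.clone _ _ (idfun \; *%R) _)
  block_form.
Proof.
by split=> u k v w; rewrite /block_form /pairing !mxE /=; case: (eps); ring.
Qed.

HB.instance Definition _ :=
  bilinear_isBilinear.Build K V V K _ _ block_form block_form_bilinear.

Fact block_form_hermitian x y :
  block_form x y = (-1) ^+ eps * idfun (block_form y x).
Proof. by rewrite /block_form /=; case: (eps); rewrite ?expr1 ?expr0; ring. Qed.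

HB.instance Definition _ :=
  isHermitianSesquilinear.Build K V eps idfun block_form block_form_hermitian.

Definition block_herm : {hermitian V for eps & idfun} := block_form.

(** Pairing [x] with the four basis vectors gives two homogeneous linear systems,
    one for each plane, with matrices [(a, b; c, d)] and its transpose; Cramer's
    rule then kills every coordinate. *)
Lemma block_form_nondegenerate : a * d - b * c != 0 -> nondegenerate block_herm.
Proof.
move=> det0; rewrite /nondegenerate -subv0; apply/subvP => x.
move=> /mem_orthovP rad_x; rewrite memv0; apply/eqP.
have eval s : block_form x (coords s) = 0 by exact: (rad_x _ (memvf _)).
have := eval [:: 0; 0; 0; 1]; have := eval [:: 0; 0; 1; 0].
have := eval [:: 0; 1; 0; 0]; have := eval [:: 1; 0; 0; 0].
have s0 : (-1) ^+ eps != 0 :> K by rewrite signr_eq0.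
rewrite /block_form /pairing !mxE /= !(mul1r, mul0r, mulr1, mulr0, addr0, add0r).
move=> /eqP; rewrite mulf_eq0 (negPf s0) /= => /eqP h0.
move=> /eqP; rewrite mulf_eq0 (negPf s0) /= => /eqP h1 h2 h3.
apply: nil3R_eq; split; rewrite mxE; apply: (mulfI det0).
- transitivity (d * (x 0 0 * a + x 0 1 * c) - c * (x 0 0 * b + x 0 1 * d)); first by ring.
  by rewrite h2 h3; ring.
- transitivity (a * (x 0 0 * b + x 0 1 * d) - b * (x 0 0 * a + x 0 1 * c)); first by ring.
  by rewrite h2 h3; ring.
- transitivity (d * (a * x 0 2 + b * x 0 3) - b * (c * x 0 2 + d * x 0 3)); first by ring.
  by rewrite h0 h1; ring.
- transitivity (a * (c * x 0 2 + d * x 0 3) - c * (a * x 0 2 + b * x 0 3)); first by ring.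
  by rewrite h0 h1; ring.
Qed.

End BlockForm.

Section BlockEnd.
Variables a b c d a' b' c' d' : K.

Definition block_fun x : V :=
  coords [:: a * x 0 0 + b * x 0 1; c * x 0 0 + d * x 0 1;
             a' * x 0 2 + b' * x 0 3; c' * x 0 2 + d' * x 0 3].

Fact block_fun_linear : linear block_fun.
Proof. by move=> k x y; apply: nil3R_eq; rewrite !mxE /=; split; ring. Qed.

HB.instance Definition _ := GRing.isLinear.Build K V V _ block_fun block_fun_linear.

Definition block_end : 'End(V) := linfun block_fun.

Lemma block_endE x : block_end x = block_fun x. Proof. exact: lfunE. Qed.

End BlockEnd.

(** * The Born structure attached to a point of the unit circle *)

Variables p q : K.

(** This is [p (e^13 + e^24) + q (e^14 - e^23)]. *)
Definition born_w : {skew_symmetric V} := block_herm true p q (- q) p.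
Definition born_g : {symmetric V} := block_herm false p q q (- p).
Definition born_h : {symmetric V} := block_herm false q (- p) p q.

Definition born_triple : form_triple V := FormTriple born_g born_h born_w.

(** On <e_1, e_2> this is the reflection fixing e_1 and on <e_3, e_4> the one
    fixing [- q e_3 + p e_4]; entries of degree 2 are the cosine and sine, up to
    sign, of the doubled angle. *)
Definition born_A := block_end 1 0 0 (-1)
  (q ^+ 2 - p ^+ 2) (- (2 * p * q)) (- (2 * p * q)) (p ^+ 2 - q ^+ 2).
(** This is [- A J]. *)
Definition born_B := block_end 0 1 1 0
  (2 * p * q) (q ^+ 2 - p ^+ 2) (q ^+ 2 - p ^+ 2) (- (2 * p * q)).
Definition born_J := block_end 0 (-1) 1 0 0 (-1) 1 0.

Hypothesis pq1 : p ^+ 2 + q ^+ 2 = 1.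

Let p2 : p ^+ 2 = 1 - q ^+ 2. Proof. by rewrite -pq1 addrK. Qed.

Lemma born_gA : is_recursion born_g born_w born_A.
Proof.
move=> x y; rewrite block_endE /= /block_form /pairing !mxE /=; ring: p2.
Qed.

Lemma born_hB : is_recursion born_g born_h born_B.
Proof.
move=> x y; rewrite block_endE /= /block_form /pairing !mxE /=; ring: p2.
Qed.

Lemma born_wJ : is_recursion born_w born_h (- born_J).
Proof.
move=> x y; rewrite opp_lfunE block_endE /= /block_form /pairing !mxE /=; ring.
Qed.

Lemma born_AA : (born_A \o born_A)%VF = \1%VF.
Proof.
apply/lfunP => x; rewrite !lfunE /= !block_endE.
by apply: nil3R_eq; rewrite !mxE /=; split; ring: p2.
Qed.

Lemma born_BB : (born_B \o born_B)%VF = \1%VF.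
Proof.
apply/lfunP => x; rewrite !lfunE /= !block_endE.
by apply: nil3R_eq; rewrite !mxE /=; split; ring: p2.
Qed.

Lemma born_JJ : (born_J \o born_J)%VF = (- \1)%VF.
Proof.
apply/lfunP => x; rewrite opp_lfunE !lfunE /= !block_endE.
by apply: nil3R_eq; rewrite !mxE /=; split; ring.
Qed.

Lemma born_w_nondegenerate : nondegenerate born_w.
Proof.
apply: block_form_nondegenerate; rewrite (_ : _ - _ = 1) ?oner_neq0 //.
ring: p2.
Qed.

Lemma born_g_nondegenerate : nondegenerate born_g.
Proof.
apply: block_form_nondegenerate; rewrite (_ : _ - _ = -1) ?oppr_eq0 ?oner_neq0 //.
ring: p2.
Qed.

Lemma born_h_nondegenerate : nondegenerate born_h.
Proof.
apply: block_form_nondegenerate; rewrite (_ : _ - _ = 1) ?oner_neq0 //.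
ring: p2.
Qed.

Lemma born_triple_is_born : is_born born_triple.
Proof.
split; [exact: born_g_nondegenerate|exact: born_h_nondegenerate|
        exact: born_w_nondegenerate|].
exists born_A, born_B, born_J; split; split.
- exact: born_gA.
- exact: born_hB.
- exact: born_wJ.
- exact: born_AA.
- exact: born_BB.
- exact: born_JJ.
Qed.

(** The bracket is a multiple of e_3, and [w] pairs e_3 only with e_1 and e_2;
    the sum is a 3 x 3 determinant with linearly dependent rows. *)
Lemma born_w_closed x y z : ce_diff born_w x y z = 0.
Proof.
by rewrite /ce_diff !nil3R_lieE /= /block_form /pairing !mxE /=; ring.
Qed.

(** On <e_1, e_2>, [J] has determinant 1, so the first two terms cancel, and
    trace 0, so the last two cancel. *)
Lemma born_J_nijenhuis x y : nijenhuis born_J x y = 0.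
Proof.
rewrite /nijenhuis !nil3R_lieE !block_endE.
by apply: nil3R_eq; rewrite !mxE /=; split; ring.
Qed.

(** Modulo <e_3, e_4>, [A] is [diag(1, -1)], so an eigenspace projects into a
    line of <e_1, e_2>, on which the determinant giving the bracket is zero. *)
Lemma lie_eigenspace_A (s : K) x y :
  x \in passmx.leigenspace born_A s -> y \in passmx.leigenspace born_A s ->
  lie x y = 0.
Proof.
rewrite !memv_ker !add_lfunE !opp_lfunE !scale_lfunE !id_lfunE !subr_eq0 !block_endE.
move=> /eqP/rowP Ax /eqP/rowP Ay; rewrite nil3R_lieE.
have := Ax 0; have := Ax 1; have := Ay 0; have := Ay 1.
rewrite !mxE /= !(mul1r, mul0r, addr0, add0r, mulN1r) => y1 y0 x1 x0.
apply: nil3R_eq; rewrite !mxE /=; split=> //.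
(* As [x 0 0 = s x 0 0] and [- y 0 1 = s y 0 1], the product is its own opposite. *)
have -> : x 0 0 * y 0 1 = 0.
  have : x 0 0 * y 0 1 = - (x 0 0 * y 0 1) by rewrite -mulrN y1 {1}x0; ring.
  by lra.
have -> : x 0 1 * y 0 0 = 0.
  have : x 0 1 * y 0 0 = - (x 0 1 * y 0 0) by rewrite -mulNr x1 {1}y0; ring.
  by lra.
exact: subrr.
Qed.

Lemma born_triple_is_integrable : is_integrable_born born_triple.
Proof.
split; first exact: born_triple_is_born.
- exact: born_w_closed.
- move=> J wJ x y; rewrite (_ : J = born_J) ?born_J_nijenhuis //.
  by apply/oppr_inj/(recursion_uniq born_w_nondegenerate wJ born_wJ).
move=> A gA; rewrite (recursion_uniq born_g_nondegenerate gA born_gA).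
by split=> x y xA yA; rewrite (lie_eigenspace_A xA yA) mem0v.
Qed.

End Coordinates.

(** * The circle of parameters *)

Section Circle.
Variable R : realType.
Implicit Types a b c d : R.

(** The span of [cos] and [sin] is stable under differentiation. *)
Lemma smooth_cos_sin c d : smooth (fun a => c * cos a + d * sin a).
Proof.
have der c' d' (x : R) : is_derive x 1 (fun a => c' * cos a + d' * sin a)
    (d' * cos x + - c' * sin x).
  have -> : d' * cos x + - c' * sin x = c' *: - sin x + d' *: cos x.
    by rewrite addrC mulNr scalerN.
  exact: is_deriveD.
suff derN n : exists c' d', derive1n n (fun a => c * cos a + d * sin a) =
    fun a => c' * cos a + d' * sin a.
  by move=> n x; have [c' [d' ->]] := derN n; case: (der c' d' x).
elim: n => [|n [c' [d' IHn]]]; first by exists c, d.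
exists d', (- c'); rewrite derive1nS IHn; apply/funext => x.
by rewrite derive1E; have [_ ->] := der c' d' x.
Qed.

Lemma cos_periodic_int a (k : int) : cos (a + k%:~R * (2 * pi)) = cos a.
Proof.
rewrite (_ : 2 * pi = pi *+ 2) ?mulr_natl // mulrzl.
case: k => n; first by rewrite -pmulrn (periodicn (@cosD2pi R)).
by rewrite NegzE mulrNz -pmulrn -[LHS](periodicn (@cosD2pi R) n.+1) addrNK.
Qed.

Lemma sin_periodic_int a (k : int) : sin (a + k%:~R * (2 * pi)) = sin a.
Proof.
by rewrite -[LHS]cosBpihalf addrAC cos_periodic_int cosBpihalf.
Qed.

(** Subtracting periods reduces to [0 <= b < 2 pi]; [cos] is injective on
    [0, pi], and the reflection [b |-> 2 pi - b] brings the other half of the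
    period there, where it would give [b = 2 pi]. *)
Lemma cos_eq1 a : cos a = 1 -> exists k : int, a = k%:~R * (2 * pi).
Proof.
have pi0 := pi_gt0 R; have pi2 : 0 < 2 * pi :> R by rewrite mulr_gt0.
move=> cosa; exists (Num.floor (a / (2 * pi))); set k := Num.floor _.
set b := a - k%:~R * (2 * pi).
have cosb : cos b = 1.
  by rewrite -cosa -(cos_periodic_int b k) subrK.
have b_ge0 : 0 <= b by rewrite subr_ge0 -ler_pdivlMr // floor_le.
have b_lt : b < 2 * pi.
  rewrite ltrBlDr -[X in X + _]mul1r -mulrDl -ltr_pdivrMr // addrC.
  by have := floorD1_gt (a / (2 * pi)); rewrite intrD.
apply/eqP; rewrite -subr_eq0 -/b; apply/eqP.
have zero c : 0 <= c <= pi -> cos c = 1 -> c = 0.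
  move=> c_itv c1; apply: cos_inj; rewrite ?cos0 // in_itv /= ?lexx ?ltW //.
have [b_le|b_gt] := leP b pi; first by apply: zero; rewrite ?b_ge0.
suff : 2 * pi - b = 0 by lra.
apply: zero; first by apply/andP; split; lra.
by rewrite -[_ * pi]mul1r addrC (cos_periodic_int _ 1) cosN.
Qed.

(** Equality of both functions at [a] and [b] gives [cos (b - a) = 1]. *)
Lemma eq_cos_sin a b : (cos a = cos b /\ sin a = sin b) <->
  exists k : int, b - a = k%:~R * (2 * pi).
Proof.
split=> [[cosE sinE]|[k /eqP]].
  by apply: cos_eq1; rewrite cosB cosE sinE -!expr2 cos2Dsin2.
by rewrite subr_eq addrC => /eqP ->; rewrite cos_periodic_int sin_periodic_int.
Qed.

Definition born_family a : form_triple (nil3R R) := born_triple (cos a) (sin a).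

Lemma smooth_born_family : smooth_triple born_family.
Proof.
move=> x y; split=> /=.
- rewrite (_ : (fun a => _) = fun a =>
    born_g 1 0 x y * cos a + born_g 0 1 x y * sin a); first exact: smooth_cos_sin.
  by apply/funext => a; rewrite /= /block_form /pairing; ring.
- rewrite (_ : (fun a => _) = fun a =>
    born_h 1 0 x y * cos a + born_h 0 1 x y * sin a); first exact: smooth_cos_sin.
  by apply/funext => a; rewrite /= /block_form /pairing; ring.
- rewrite (_ : (fun a => _) = fun a =>
    born_w 1 0 x y * cos a + born_w 0 1 x y * sin a); first exact: smooth_cos_sin.
  by apply/funext => a; rewrite /= /block_form /pairing; ring.
Qed.

Lemma eq_born_family a b : eq_triple (born_family a) (born_family b) <->
  cos a = cos b /\ sin a = sin b.
Proof.
split=> [[_ _ eq_w]|[cosE sinE]]; last by rewrite /born_family cosE sinE.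
have := eq_w (coords [:: 1; 0; 0; 0]) (coords [:: 0; 0; 1; 0]).
have := eq_w (coords [:: 1; 0; 0; 0]) (coords [:: 0; 0; 0; 1]).
rewrite /= /block_form /pairing !mxE /=.
by rewrite !(mul1r, mul0r, mulr1, mulr0, addr0, add0r).
Qed.

End Circle.

Theorem theorem40 (R : realType) :
  exists F : R -> form_triple (nil3R R),
    is_circle_family F /\ forall a : R, is_integrable_born (F a).
Proof.
exists (@born_family R); split; last first.
  by move=> a; apply: born_triple_is_integrable; exact: cos2Dsin2.
split=> [|a b]; first exact: smooth_born_family.
exact: iff_trans (eq_born_family a b) (eq_cos_sin a b).
Qed.
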